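(* Let $\Gamma$ be an $n$-player extensive-form game with perfect recall. An extensive-form correlation plan $\xi\in\Xi$ is an EFCCE if and only if the following inequality holds for any player $i\in\{1,\dots,n\}$, any information set $\hat I\in\mathcal I_i$, and any sequence-form strategy $y_{i,\hat I}\in Q_i$ such that $y_{i,\hat I}(\sigma_i(\hat I))=1$: $$\sum_{z\in Z_{\hat I}}u_i(z)\,\xi_i(\sigma_i(\hat I);z)\,y_{i,\hat I}(\sigma_i(z))\ \le\ \sum_{z\in Z_{\hat I}}u_i(z)\,\xi_i(\sigma_i(z);z).$$
   Context: **Game.** $\Gamma$ is an $n$-player extensive-form game with perfect recall. Each non-leaf node $v$ belongs to a player $i\in\{1,\dots,n\}$ or to the chance player $\mathsf c$; $A_v$ is its set of actions. $Z$ is the set of leaves, $u_i(z)\in\mathbb R$ Player $i$'s payoff at $z$. The nodes of Player $i$ are partitioned into a collection $\mathcal I_i$ of information sets, with common action set $A_I$ at $I$. $Z_{\hat I}$ is the set of leaves $z$ whose path from the root passes through a node of $\hat I$. **Sequences.** $\Sigma_i=\{(I,a): I\in\mathcal I_i,a\in A_I\}\cup\{\varnothing_i\}$. For a node $v$, $\sigma_i(v)$ is the last $(I,a)\in\Sigma_i$ encountered on the path from the root to $v$, or $\varnothing_i$ if none; $\sigma_i(I)=\sigma_i(v)$ for any $v\in I\in\mathcal I_i$. Information sets $I_i\in\mathcal I_i$, $I_j\in\mathcal I_j$ are connected if there are $u\in I_i$, $v\in I_j$ such that the path from the root to $u$ passes through $v$ or vice versa. For $i\neq j$, sequences $\sigma_i\in\Sigma_i$,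 $\sigma_j\in\Sigma_j$ are relevant if one of them is empty or their information sets are connected. **Plans.** A reduced-normal-form plan $\pi$ of Player $i$ selects an action $\pi(I)\in A_I$ at exactly those $I\in\mathcal I_i$ reachable given its own other choices. $\Pi_i$ is the set of such plans; $\Pi_i(\varnothing_i)=\Pi_i$, $\Pi_i((I,a))=\Pi_i(\sigma_i(I))\cap\{\pi:\pi(I)=a\}$; $\Pi_i(z)=\Pi_i(\sigma_i(z))$ for $z\in Z$ and $\Pi_i(I)=\Pi_i(\sigma_i(I))$ for $I\in\mathcal I_i$. **Sequence-form strategies.** $Q_i\subseteq\mathbb R_{\ge0}^{\Sigma_i}$ is the set of vectors $y$ of the form $y(\sigma)=\sum_{\pi\in\Pi_i(\sigma)}\hat\mu(\pi)$ for a probability distribution $\hat\mu$ over $\Pi_i$. **Correlation plans.** A distribution $\mu$ over $\Pi_1\times\dots\times\Pi_n$ induces the vector $\xi$, indexed by tuples $(\sigma_1,\dots,\sigma_n)\in\Sigma_1\times\dots\times\Sigma_n$ of pairwise-relevant sequences, with $\xi(\sigma_1,\dots,\sigma_n)=\sum_{\pi_1\in\Pi_1(\sigma_1),\dots,\pi_n\in\Pi_n(\sigma_n)}\mu(\pi_1,\dots,\pi_n)$. $\Xi$ is the set of all such $\xi$. Write $\xi_i(\sigma;z)=\xi(\sigma_1(z),\dots,\sigma_{i-1}(z),\sigma,\sigma_{i+1}(z),\dots,\sigma_n(z))$. **EFCCE (extensive-form coarse-correlated equilibrium).** For $\hat I\in\mathcal I_i$ and a distribution $\hat\mu$ over $\Pi_i(\hat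 I)$, the $(\hat I,\hat\mu)$-trigger agent for Player $i$ commits to and follows all recommendations (sampled from $\mu$) until reaching a node of $\hat I$ (if ever), and from then on plays a plan sampled from $\hat\mu$ (independently of $\mu$) until the game ends. With all other players following recommendations, its expected utility is expressed as $\hat u_{\hat I}=\sum_{z\in Z_{\hat I}}u_i(z)\,p_z+\sum_{z\in Z\setminus Z_{\hat I}}u_i(z)\,q_z$, where $$p_z=\Big(\sum_{\pi_i\in\Pi_i(\hat I),\ \pi_j\in\Pi_j(z)\,\forall j\ne i}\mu(\pi_1,\dots,\pi_n)\Big)\Big(\sum_{\pi_i\in\Pi_i(z)}\hat\mu(\pi_i)\Big),\qquad q_z=\sum_{\pi_j\in\Pi_j(z)\,\forall j}\mu(\pi_1,\dots,\pi_n).$$ $\mu$ is an EFCCE if for every player $i$, every $\hat I\in\mathcal I_i$ and every $\hat\mu$ over $\Pi_i(\hat I)$, $\hat u_{\hat I}\le u_i$, where $u_i=\sum_{z\in Z}u_i(z)\sum_{\pi_j\in\Pi_j(z)\,\forall j}\mu(\pi_1,\dots,\pi_n)$ is the utility of following all recommendations. A correlation plan $\xi\in\Xi$ is called an EFCCE if it is induced by some $\mu$ that is an EFCCE. *)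

(* Defs.v *)
From HB Require Import structures.
From mathcomp Require Import all_boot all_order all_algebra.
From mathcomp Require Import boolp reals.

Set Implicit Arguments.
Unset Strict Implicit.
Unset Printing Implicit Defensive.

Import Order.TTheory GRing.Theory Num.Theory.
Local Open Scope ring_scope.

(* [parent v = Some (u, a)] means that v is reached from its parent u by playing
   a at u.  Injectivity says that the child reached by a at u is unique, and
   also that [start], the root, is the only node without parent. *)
Record gameTree := GameTree {
  node : finType;
  action : finType;
  start : node;
  parent : node -> option (node * action);
  parent_start : parent start = None;
  parent_inj : injective parent;
  start_connect : forall v : node,
    connect (fun u w => omap fst (parent w) == Some u) start v
}.

Section Tree.
Variable T : gameTree.
Implicit Types (u v : node T) (I J : {set node T}).

Definition actions v : {set action T} :=
  [set a | [exists w, parent w == Some (v, a)]].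

Definition leaf v : bool := actions v == set0.

Fixpoint path_rec (k : nat) v : seq (node T * action T) :=
  if k is k'.+1 then
    if parent v is Some (u, a) then rcons (path_rec k' u) (u, a) else [::]
  else [::].

(* The (node, action) steps from the root to v; #|node T| bounds the depth. *)
Definition path_to v := path_rec #|node T| v.

Definition passes_through v u : bool := u \in rcons (unzip1 (path_to v)) v.

Definition leaves_below I : {set node T} :=
  [set z | leaf z & [exists v in I, passes_through z v]].

Definition connected I J : bool :=
  [exists u in I, exists v in J, passes_through u v || passes_through v u].

(* Some (I, a), or None for the empty sequence; which of these belong to
   player i is the predicate [Sigma] below. *)
Definition sequence : Type := option ({set node T} * action T).
HB.instance Definition _ := Finite.on sequence.

Definition relevant (s t : sequence) : bool :=
  match s, t with
  | Some s1, Some t1 => connected s1.1 t1.1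
  | _, _ => true
  end.

(* The information sets of a single player are pairwise disjoint, so a partial
   map from sets of nodes to actions represents a plan. *)
Definition plan : Type := {ffun {set node T} -> option (action T)}.
HB.instance Definition _ := Finite.on plan.

End Tree.

(* [owner v = None] means that v is a chance node; the owner of a leaf is
   meaningless.  There are no chance probabilities: they do not occur in the
   expected utilities below, which amounts to counting the probability that
   chance plays towards z in [payoff i z]. *)
Record game (R : realType) (n : nat) := Game {
  tree :> gameTree;
  owner : node tree -> option 'I_n;
  payoff : 'I_n -> node tree -> R;
  infosets : 'I_n -> {set {set node tree}};
  infosets_partition : forall i,
    partition (infosets i) [set v | ~~ leaf v & owner v == Some i];
  infosets_actions : forall i (I : {set node tree}) u v,
    I \in infosets i -> u \in I -> v \in I -> actions u = actions v
}.

(* Vectors indexed by D are finite functions on the subtype D; [component] reads a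
   coordinate, the value 0 outside D being a dummy. *)
Definition component (R : realType) (T : finType) (D : pred T)
    (v : {ffun {x | D x} -> R}) (x : T) : R :=
  if insub x is Some d then v d else 0.

Definition distribution (R : realType) (T : finType) (S : {set T})
    (p : {ffun T -> R}) : Prop :=
  [/\ forall x, 0 <= p x, forall x, x \notin S -> p x = 0
    & \sum_x p x = 1].

Section Game.
Variables (R : realType) (n : nat) (G : game R n).
Implicit Types (i j : 'I_n) (v z : node G) (I : {set node G}).

Definition own_history i v : seq ({set node G} * action G) :=
  [seq (pblock (infosets G i) s.1, s.2) | s <- path_to v
                                        & owner s.1 == Some i].

Definition perfect_recall : Prop :=
  forall i I u v, I \in infosets G i -> u \in I -> v \in I ->
    own_history i u = own_history i v.

Definition seq_at i v : sequence G :=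
  last None [seq Some s | s <- own_history i v].

(* Independent of the chosen node of I under perfect recall. *)
Definition seq_into i I : sequence G :=
  if [pick v in I] is Some v then seq_at i v else None.

Definition info_actions I : {set action G} := \bigcup_(v in I) actions v.

Definition Sigma i : pred (sequence G) :=
  fun s => if s is Some s1
           then (s1.1 \in infosets G i) && (s1.2 \in info_actions s1.1)
           else true.

Definition reachable i (pi : plan G) I : bool :=
  [exists v in I, all (fun s => pi s.1 == Some s.2) (own_history i v)].

Definition Plans i : {set plan G} :=
  [set pi : plan G | [forall I,
    if pi I is Some a
    then [&& I \in infosets G i, reachable i pi I & a \in info_actions I]
    else ~~ ((I \in infosets G i) && reachable i pi I)]].

Inductive plays i (pi : plan G) : sequence G -> Prop :=
| plays_empty : pi \in Plans i -> plays i pi None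
| plays_action I a :
    plays i pi (seq_into i I) -> pi I = Some a -> plays i pi (Some (I, a)).

Definition PlansSeq i (s : sequence G) : {set plan G} :=
  [set pi | `[< plays i pi s >]].
Definition PlansLeaf i z := PlansSeq i (seq_at i z).
Definition PlansInfo i I := PlansSeq i (seq_into i I).

Definition seq_vector i : Type := {ffun {s | Sigma i s} -> R}.

Definition in_Q i (y : seq_vector i) : Prop :=
  exists2 muh : {ffun plan G -> R}, distribution (Plans i) muh &
    forall s : {s | Sigma i s}, y s = \sum_(pi in PlansSeq i (val s)) muh pi.

Definition profile : Type := {ffun 'I_n -> plan G}.
HB.instance Definition _ := Finite.on profile.

Definition Profiles : {set profile} :=
  [set p : profile | [forall i, p i \in Plans i]].

Definition seq_profile : Type := {ffun 'I_n -> sequence G}.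
HB.instance Definition _ := Finite.on seq_profile.

Definition relevant_profile : pred seq_profile :=
  fun s => [forall i, Sigma i (s i)] &&
           [forall i, forall j, (i != j) ==> relevant (s i) (s j)].

Definition corr_vector : Type := {ffun {s | relevant_profile s} -> R}.

Definition induces (mu : {ffun profile -> R}) (xi : corr_vector) : Prop :=
  forall s : {s | relevant_profile s},
    xi s = \sum_(p : profile | [forall j, p j \in PlansSeq j (val s j)]) mu p.

Definition in_Xi (xi : corr_vector) : Prop :=
  exists2 mu, distribution Profiles mu & induces mu xi.

Definition xi_dev (xi : corr_vector) i (s : sequence G) z : R :=
  component xi [ffun j => if j == i then s else seq_at j z].

Definition reach_follow (mu : {ffun profile -> R}) z : R :=
  \sum_(p : profile | [forall j, p j \in PlansLeaf j z]) mu p.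

Definition reach_trigger (mu : {ffun profile -> R}) i I
    (muh : {ffun plan G -> R}) z : R :=
  (\sum_(p : profile | (p i \in PlansInfo i I) &&
                       [forall j, (j != i) ==> (p j \in PlansLeaf j z)]) mu p)
  * (\sum_(pi in PlansLeaf i z) muh pi).

Definition utility (mu : {ffun profile -> R}) i : R :=
  \sum_(z | leaf z) payoff i z * reach_follow mu z.

Definition trigger_utility (mu : {ffun profile -> R}) i I
    (muh : {ffun plan G -> R}) : R :=
  \sum_(z in leaves_below I) payoff i z * reach_trigger mu i I muh z
  + \sum_(z | leaf z && (z \notin leaves_below I))
      payoff i z * reach_follow mu z.

Definition EFCCE_dist (mu : {ffun profile -> R}) : Prop :=
  forall i I, I \in infosets G i ->
  forall muh, distribution (PlansInfo i I) muh ->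
    trigger_utility mu i I muh <= utility mu i.

Definition EFCCE (xi : corr_vector) : Prop :=
  exists mu, [/\ distribution Profiles mu, induces mu xi & EFCCE_dist mu].

End Game.

Arguments seq_vector {R n} G i.
Arguments Sigma {R n} G i _.

(* Main.v *)
(* Write s for the sequence of player i leading into I.  Perfect recall makes s
   the sequence of i at whichever node of I lies above a leaf z below I, so every
   profile of sequences read by the inequality consists of information sets met
   on the single path to z; hence it is relevant, and xi gives there the
   probabilities occurring in the two utilities.  The distributions on the plans
   in Pi_i(I) are those on Pi_i whose sequence-form vector takes the value 1 at s,
   and the leaves that are not below I contribute equally to both utilities. *)

Require Import Defs.
From mathcomp Require Import all_boot all_order all_algebra.
From mathcomp Require Import boolp reals.
Local Open Scope ring_scope.

Set Implicit Arguments.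
Unset Strict Implicit.
Unset Printing Implicit Defensive.

Import Order.TTheory GRing.Theory Num.Theory.

Section TreePaths.
Variable T : gameTree.
Implicit Types (u v w z : node T) (I J : {set node T}).

Let child_of u w := omap fst (parent w) == Some u.

(** The recursion stops at the root, so fuel beyond the length of a path from the root is never
    consumed. *)
Lemma path_rec_stable p k :
  path child_of (start T) p -> (size p <= k)%N ->
  path_rec k (last (start T) p) = path_rec (size p) (last (start T) p).
Proof.
elim/last_ind: p k => [|p w IH] k /=; first by case: k => //= k; rewrite parent_start.
rewrite rcons_path last_rcons size_rcons => /andP[pp].
case: k => // k; rewrite /child_of /= ltnS.
by case: (parent w) => [[u a]|] //= /eqP[->] /(IH _ pp) ->.
Qed.

Lemma path_toE v :
  path_to v = if parent v is Some (u, a) then rcons (path_to u) (u, a) else [::].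
Proof.
(* One extra unit of fuel makes the recursion unfold to exactly [path_to u] at the parent; it is
   harmless because a duplicate-free path from the root has fewer than [#|node T|] steps. *)
suff {1}-> : path_to v = path_rec #|node T|.+1 v by [].
have /connectP[p0 /shortenP[p pp pU _] ->] := start_connect v.
have lep : (size p <= #|node T|)%N.
  by apply: ltnW; move/card_uniqP: pU => /= <-; apply: max_card.
by rewrite /path_to !(path_rec_stable pp) // ltnW.
Qed.

(** Induction away from the root, justified by running along a path given by [start_connect]. *)
Lemma tree_ind (P : node T -> Prop) :
  P (start T) -> (forall u v a, parent v = Some (u, a) -> P u -> P v) ->
  forall v, P v.
Proof.
move=> P0 PS v; have /connectP[p pp ->] := start_connect v.
elim/last_ind: p pp => [//|p w IH]; rewrite rcons_path last_rcons => /andP[/IH Pu].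
by case Ew: (parent w) => [[u a]|] //= /eqP[Eu]; apply: PS Ew _; rewrite Eu.
Qed.

Lemma passes_throughE v u :
  passes_through v u =
  (u == v) || (if parent v is Some (w, _) then passes_through w u else false).
Proof.
rewrite /passes_through mem_rcons inE path_toE; case: (parent v) => [[w a]|] //.
by rewrite /unzip1 map_rcons.
Qed.

Lemma passes_through_refl v : passes_through v v.
Proof. by rewrite passes_throughE eqxx. Qed.

Lemma passes_through_trans v z u :
  passes_through z v -> passes_through v u -> passes_through z u.
Proof.
elim/tree_ind: z => [|w z a Ez IH].
  by rewrite passes_throughE parent_start orbF => /eqP->.
rewrite passes_throughE Ez => /predU1P[->//|/IH{}IH /IH].
by rewrite (passes_throughE z) Ez => ->; rewrite orbT.
Qed.

(** Since every node has at most one parent, the nodes above [z] form a chain. *)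
Lemma passes_through_total z u v :
  passes_through z u -> passes_through z v ->
  passes_through u v || passes_through v u.
Proof.
elim/tree_ind: z => [|w z a Ez IH].
  rewrite !passes_throughE parent_start !orbF => /eqP-> /eqP->.
  by rewrite eqxx.
rewrite (passes_throughE z u) => /predU1P[->->//|].
rewrite (passes_throughE z v) Ez => wu /predU1P[->|]; last exact: IH wu.
by rewrite (passes_throughE z u) Ez wu !orbT.
Qed.

Lemma path_to_passes_through v u a : (u, a) \in path_to v -> passes_through v u.
Proof.
by move=> uv; rewrite /passes_through mem_rcons inE (map_f fst uv) orbT.
Qed.

Lemma path_to_action v u a : (u, a) \in path_to v -> a \in actions u.
Proof.
elim/tree_ind: v => [|w v b Ev IH]; rewrite path_toE ?parent_start // Ev.
rewrite mem_rcons inE => /predU1P[[-> ->]|//].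
by rewrite inE; apply/existsP; exists v; rewrite Ev.
Qed.

End TreePaths.

Section GameSequences.
Variables (R : realType) (n : nat) (G : game R n).
Implicit Types (i j : 'I_n) (u v z : node G) (I J : {set node G}).

(** Links the list-based [seq_at] to the partition: the last step of [i] on the path to [v] starts
    at a node [u] whose block is [J]. *)
Lemma seq_at_some i v J a : seq_at i v = Some (J, a) ->
  [/\ J \in infosets G i, a \in info_actions J
    & exists2 u, u \in J & passes_through v u].
Proof.
move=> E; have : Some (J, a) \in [seq Some s | s <- own_history i v].
  by move: E; rewrite /seq_at; case: own_history => //= s l <-; exact: mem_last.
case/mapP => s /mapP[[u b]]; rewrite mem_filter /= => /andP[ou ub] -> [-> ->].
have ua := path_to_action ub.
have uC : u \in cover (infosets G i).
  have /and3P[/eqP-> _ _] := infosets_partition G i.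
  (* The action [b] played at [u] shows that [u] is not a leaf, so the partition covers it. *)
  by rewrite inE ou andbT; apply/set0Pn; exists b.
have uJ : u \in pblock (infosets G i) u by rewrite mem_pblock.
split; first exact: pblock_mem.
  by apply/bigcupP; exists u.
by exists u; last exact: path_to_passes_through ub.
Qed.

Lemma Sigma_seq_at i v : Sigma G i (seq_at i v).
Proof. by case E: seq_at => [[J a]|//]; case/seq_at_some: E => /= -> ->. Qed.

Lemma seq_intoE i I v : perfect_recall G -> I \in infosets G i -> v \in I ->
  seq_into i I = seq_at i v.
Proof.
move=> recall II vI; rewrite /seq_into; case: pickP => [u uI|/(_ v)]; last by rewrite vI.
by rewrite /seq_at (recall i I u v).
Qed.

Lemma infoset_nonempty i I : I \in infosets G i -> exists v, v \in I.
Proof.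
move=> II; apply/set0Pn; apply: contraTneq II => ->.
by have /and3P[] := infosets_partition G i.
Qed.

(** Both information sets are met on the path to [z], where any two nodes are comparable. *)
Lemma relevant_seq_at i j z u v :
  passes_through z u -> passes_through z v ->
  relevant (seq_at i u) (seq_at j v).
Proof.
move=> zu zv.
case Eu: (seq_at i u) => [[I a]|//]; case Ev: (seq_at j v) => [[J b]|//] /=.
have [_ _ [x xI ux]] := seq_at_some Eu; have [_ _ [y yJ vy]] := seq_at_some Ev.
apply/existsP; exists x; rewrite xI; apply/existsP; exists y; rewrite yJ /=.
exact: passes_through_total (passes_through_trans zu ux) (passes_through_trans zv vy).
Qed.

Lemma plays_Plans i (pi : plan G) s : plays i pi s -> pi \in Plans G i.
Proof. by elim. Qed.

Lemma componentE (T : finType) (D : pred T) (v : {ffun {x | D x} -> R}) x (Dx : D x) :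
  component v x = v (exist _ x Dx).
Proof. by rewrite /component insubT. Qed.

(** For [v] in the trigger information set, the right-hand side is the first factor of
    [reach_trigger]. Relevance of the index guarantees that [component] does not return its dummy
    0. *)
Lemma xi_devE (mu : {ffun profile G -> R}) (xi : corr_vector G) i v z :
  induces mu xi -> passes_through z v ->
  xi_dev xi i (seq_at i v) z =
  \sum_(p : profile G | (p i \in PlansSeq i (seq_at i v)) &&
                        [forall j, (j != i) ==> (p j \in PlansLeaf j z)]) mu p.
Proof.
move=> mu_xi zv; rewrite /xi_dev; set s := [ffun j => _].
(* Every coordinate of [s] is a sequence read at a node [w j] on the path to [z], so relevance needs
   no case analysis on the players. *)
pose w j := if j == i then v else z.
have sE j : s j = seq_at j (w j) by rewrite ffunE /w; case: eqP => [->|].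
have zw j : passes_through z (w j).
  by rewrite /w; case: ifP => // _; exact: passes_through_refl.
have srel : relevant_profile s.
  apply/andP; split; apply/forallP => j; rewrite sE ?Sigma_seq_at //.
  by apply/forallP => k; rewrite sE (@relevant_seq_at _ _ z) // implybT.
rewrite (componentE xi srel) mu_xi; apply: eq_bigl => p /=.
apply/forallP/andP => [ps|[psi /forallP ps] j].
  split; first by have := ps i; rewrite sE /w eqxx.
  apply/forallP => j; apply/implyP => ji.
  by have := ps j; rewrite sE /w (negPf ji).
rewrite sE /w; have [->//|ji] := eqVneq j i.
by have := ps j; rewrite ji.
Qed.

Lemma xi_dev_follow (mu : {ffun profile G -> R}) (xi : corr_vector G) i z :
  induces mu xi -> xi_dev xi i (seq_at i z) z = reach_follow mu z.
Proof.
move=> mu_xi; rewrite (xi_devE _ mu_xi (passes_through_refl z)).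
apply: eq_bigl => p; apply/andP/forallP => [[pi /forallP ps] j|ps].
  by have [->//|ji] := eqVneq j i; have := ps j; rewrite ji.
by split; [exact: ps | apply/forallP => j; rewrite ps implybT].
Qed.

Lemma trigger_utility_le (mu : {ffun profile G -> R}) i I (muh : {ffun plan G -> R}) :
  (trigger_utility mu i I muh <= utility mu i) =
  (\sum_(z in leaves_below I) payoff i z * reach_trigger mu i I muh z <=
   \sum_(z in leaves_below I) payoff i z * reach_follow mu z).
Proof.
rewrite /trigger_utility /utility (bigID (fun z => z \in leaves_below I) (@leaf G)) /=.
rewrite lerD2r; congr (_ <= _); apply: eq_bigl => z.
by rewrite inE andbA andbb.
Qed.

(** The two inequalities agree leaf by leaf for a fixed deviation; both directions of the theorem
    rewrite with this equality. *)
Lemma EFCCE_condition (mu : {ffun profile G -> R}) (xi : corr_vector G) i I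
    (muh : {ffun plan G -> R}) (y : seq_vector G i) :
  perfect_recall G -> induces mu xi -> I \in infosets G i ->
  (forall s : {s | Sigma G i s}, y s = \sum_(pi in PlansSeq i (val s)) muh pi) ->
  (trigger_utility mu i I muh <= utility mu i) =
  (\sum_(z in leaves_below I)
      payoff i z * xi_dev xi i (seq_into i I) z * component y (seq_at i z)
   <= \sum_(z in leaves_below I) payoff i z * xi_dev xi i (seq_at i z) z).
Proof.
move=> recall mu_xi II yE; rewrite trigger_utility_le.
congr (_ <= _); apply: eq_bigr => z; last by rewrite (xi_dev_follow _ _ mu_xi).
rewrite inE => /andP[_ /existsP[v /andP[vI zv]]].
rewrite /reach_trigger /PlansInfo (seq_intoE recall II vI) (xi_devE _ mu_xi zv).
by rewrite (componentE y (Sigma_seq_at i z)) yE mulrA.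
Qed.

(** If the subset already carries mass 1, the nonnegative weights outside it sum to 0, hence each of
    them vanishes. *)
Lemma distribution_PlansSeq i s (muh : {ffun plan G -> R}) :
  distribution (PlansSeq i s) muh <->
  distribution (Plans G i) muh /\ \sum_(pi in PlansSeq i s) muh pi = 1.
Proof.
have sub pi : pi \in PlansSeq i s -> pi \in Plans G i.
  by rewrite inE => /asboolP/plays_Plans.
have sumE := bigID (fun pi => pi \in PlansSeq i s) predT (fun pi => muh pi).
split=> [[ge0 out tot]|[[ge0 out tot] tot_s]].
  split; first by split=> // pi /(contra (@sub pi))/out.
  by rewrite -tot sumE /= [X in _ + X]big1 ?addr0.
have out0 : \sum_(pi | pi \notin PlansSeq i s) muh pi = 0.
  by apply: (addrI (1 : R)); rewrite addr0 -{1}tot_s -tot sumE.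
by split=> // pi pi_s; apply: (psumr_eq0P _ out0) => // *; exact: ge0.
Qed.

End GameSequences.

Theorem proposition2 (R : realType) (n : nat) (G : game R n)
    (recall : perfect_recall G) (xi : corr_vector G) (Hxi : in_Xi xi) :
  EFCCE xi <->
  (forall (i : 'I_n) (I : {set node G}), I \in infosets G i ->
   forall y : seq_vector G i, in_Q y ->
   component y (seq_into i I) = 1 ->
   \sum_(z in leaves_below I)
      payoff i z * xi_dev xi i (seq_into i I) z * component y (seq_at i z)
   <= \sum_(z in leaves_below I)
        payoff i z * xi_dev xi i (seq_at i z) z).
Proof.
have yI i I (y : seq_vector G i) (muh : {ffun plan G -> R}) : I \in infosets G i ->
    (forall s : {s | Sigma G i s}, y s = \sum_(pi in PlansSeq i (val s)) muh pi) ->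
    component y (seq_into i I) = \sum_(pi in PlansInfo i I) muh pi.
  move=> II yE; have [v vI] := infoset_nonempty II.
  rewrite /PlansInfo (seq_intoE recall II vI).
  by rewrite (componentE y (Sigma_seq_at i v)) yE.
(* The distribution witnessing [in_Q y] is itself the strategy of the trigger agent. *)
split=> [[mu [_ mu_xi mu_eq]] i I II y [muh muh_distr yE] y1|ineq].
  rewrite -(EFCCE_condition recall mu_xi II yE); apply: mu_eq => //.
  by apply/distribution_PlansSeq; split=> //; rewrite -(yI _ _ _ _ II yE).
(* Any [mu] inducing [xi] will do, because the inequality depends on [mu] only through [xi]. *)
case: Hxi => mu mu_distr mu_xi; exists mu; split=> // i I II muh.
case/distribution_PlansSeq => muh_distr muh1.
pose y : seq_vector G i := [ffun s => \sum_(pi in PlansSeq i (val s)) muh pi].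
have yE s : y s = \sum_(pi in PlansSeq i (val s)) muh pi by rewrite ffunE.
rewrite (EFCCE_condition recall mu_xi II yE); apply: ineq => //.
  by exists muh.
by rewrite (yI _ _ _ _ II yE).
Qed.
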